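(* Let $X$ be a topological space, let $\alpha:X\to X$ be a bijection such that $\alpha$ and $\alpha^{-1}$ are Borel measurable, and let $\mathcal F$ be a Banach function space on $X$ satisfying condition $\Omega_\alpha$. Let $w$ and $\frac1w$ be weight functions on $X$. Suppose that for each compact subset $K\subseteq X$ there are sequences $(D_k)$, $(E_k)$ and $(F_k)$ of Borel subsets of $K$ and an increasing sequence $(n_k)$ of positive integers such that for each $k$, $D_k=E_k\cup F_k$ and $E_k\cap F_k=\varnothing$, and moreover $\lim_{k\to\infty}\|\chi_{K\setminus D_k}\|_{\mathcal F}=0$, $$\lim_{k\to\infty}\left\|\chi_{D_k}\cdot\left(\prod_{s=1}^{n_k}w\circ\alpha^{-s}\right)\right\|_{\mathcal F}=\lim_{k\to\infty}\left\|\chi_{D_k}\cdot\left(\prod_{s=0}^{n_k-1}w\circ\alpha^{s}\right)^{-1}\right\|_{\mathcal F}=0$$ and $$\lim_{k\to\infty}\left\|\chi_{E_k}\cdot\left(\prod_{s=1}^{2n_k}w\circ\alpha^{-s}\right)\right\|_{\mathcal F}=\lim_{k\to\infty}\left\|\chi_{F_k}\cdot\left(\prod_{s=0}^{2n_k-1}w\circ\alpha^{s}\right)^{-1}\right\|_{\mathcal F}=0.$$ Then the sequence $(C^{(n)}_{\alpha,w})_{n\in\mathbb N_0}$ is topologically transitive on $\mathcal F$.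
   Context: Notation: $\mathbb N_0=\mathbb N\cup\{0\}$; $\mathcal M_0(X)$ is the set of all Borel measurable complex-valued functions on $X$; $\chi_A$ is the characteristic function of $A$; $\alpha^s$ is the $s$-fold composition of $\alpha$ (and $\alpha^{-s}$ that of $\alpha^{-1}$). Banach function space on $X$: a linear subspace $\mathcal F$ of $\mathcal M_0(X)$ equipped with a norm $\|\cdot\|_{\mathcal F}$ making it a Banach space. Standing assumption: $\mathcal F$ is separable and infinite-dimensional. Solid: if $f\in\mathcal F$, $g\in\mathcal M_0(X)$ and $|g|\le|f|$, then $g\in\mathcal F$ and $\|g\|_{\mathcal F}\le\|f\|_{\mathcal F}$. $\alpha$-invariant: for each $f\in\mathcal F$, $f\circ\alpha^{\pm1}\in\mathcal F$ and $\|f\circ\alpha^{\pm1}\|_{\mathcal F}=\|f\|_{\mathcal F}$. Condition $\Omega_\alpha$: (1) $\mathcal F$ is solid and $\alpha$-invariant; (2) $\chi_E\in\mathcal F$ for each compact $E\subseteq X$; (3) the set $\mathcal F_{bc}$ of all bounded compactly supported functions in $\mathcal F$ is dense in $\mathcal F$. Weight: a bounded Borel measurable function $w:X\to(0,\infty)$. For weights $w,\frac1w$, define $T_{\alpha,w}f:=w\cdot(f\circ\alpha)$ for $f\in\mathcal F$; this is a bounded invertible operator on $\mathcal F$, with inverse $S_{\alpha,w}f=\frac{f\circ\alpha^{-1}}{w\circ\alpha^{-1}}$. Put $C^{(n)}_{\alpha,w}:=\frac12(T^n_{\alpha,w}+S^n_{\alpha,w})$. A sequence $(T_n)_{n\in\mathbb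 N_0}$ of bounded linear operators on a Banach space $\mathcal X$ is topologically transitive if for all non-empty open $U,V\subseteq\mathcal X$ there is $n\in\mathbb N$ with $T_n(U)\cap V\ne\varnothing$. *)

(* Defs.v *)
From HB Require Import structures.
From mathcomp Require Import all_boot all_order all_algebra.
From mathcomp Require Import all_classical all_reals all_analysis.
From mathcomp Require Import complex.

Set Implicit Arguments.
Unset Strict Implicit.
Unset Printing Implicit Defensive.

Import Order.TTheory GRing.Theory Num.Theory.
Import numFieldNormedType.Exports.

Local Open Scope classical_set_scope.
Local Open Scope complex_scope.
Local Open Scope ring_scope.

(* [measurableType]s are pointed, so the Borel structure of an arbitrary
   [topologicalType] is expressed directly with generated sigma-algebras. *)
Definition borel (T : topologicalType) : set (set T) := <<s @open T >>.

Definition borel_fun (S T : topologicalType) (f : S -> T) : Prop :=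
  forall B : set T, borel B -> borel (f @^-1` B).

Definition separable (T : topologicalType) : Prop :=
  exists A : set T, countable A /\ dense A.

Definition infinite_dimensional (K : fieldType) (V : lmodType K) : Prop :=
  ~ exists (n : nat) (e : 'I_n -> V),
      forall v : V, exists c : 'I_n -> K, v = \sum_i c i *: e i.

Definition topologically_transitive (V : topologicalType) (T : nat -> V -> V) :
    Prop :=
  forall U W : set V, open U -> open W -> U !=set0 -> W !=set0 ->
    exists2 n, (0 < n)%N & (T n @` U) `&` W !=set0.

(* [R[i]^o] carries the complex topology and the C-module structure; the bare
   type [R[i]] is seen by the library as a module over [R]. *)
Record normedFunctionSpace (R : realType) (X : topologicalType) := {
  nfs_set : set (X -> R[i]^o) ;
  (* only the values on [nfs_set] are meaningful *)
  nfs_norm : (X -> R[i]^o) -> R ;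
  nfs_borel : forall f, nfs_set f -> borel_fun f ;
  nfs_0 : nfs_set 0 ;
  nfs_add : forall f g, nfs_set f -> nfs_set g -> nfs_set (f + g) ;
  nfs_scale : forall (a : R[i]) f, nfs_set f -> nfs_set (a *: f) ;
  nfs_norm_triangle : forall f g, nfs_set f -> nfs_set g ->
    nfs_norm (f + g) <= nfs_norm f + nfs_norm g ;
  nfs_normZ : forall (a : R[i]) f, nfs_set f ->
    (nfs_norm (a *: f))%:C = `|a| * (nfs_norm f)%:C ;
  nfs_norm_eq0 : forall f, nfs_set f -> nfs_norm f = 0 -> f = 0
}.

Section NormedFunctionSpace.
Context (R : realType) (X : topologicalType) (F : normedFunctionSpace R X).

Definition nfs_pred : {pred X -> R[i]^o} := mem (nfs_set F).

Lemma nfs_submod_closed : submod_closed nfs_pred.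
Proof.
split=> [|a f g]; first by rewrite inE; exact: nfs_0.
by rewrite !inE => Ff Fg; apply: nfs_add => //; exact: nfs_scale.
Qed.

HB.instance Definition _ :=
  GRing.isSubmodClosed.Build _ _ nfs_pred nfs_submod_closed.

Record nfs_sort :=
  NfsSort { nfs_fun :> X -> R[i]^o ; nfs_funP : nfs_fun \in nfs_pred }.

HB.instance Definition _ := [isSub for nfs_fun].
HB.instance Definition _ := [Choice of nfs_sort by <:].
HB.instance Definition _ := [SubChoice_isSubLmodule of nfs_sort by <:].

Lemma nfs_sortP (f : nfs_sort) : nfs_set F f.
Proof. exact: set_mem (nfs_funP f). Qed.

Let norm (f : nfs_sort) : R[i] := (nfs_norm F f)%:C.

Let norm_triangle f g : norm (f + g) <= norm f + norm g.
Proof.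
rewrite /norm -rmorphD/= lecR.
exact: (nfs_norm_triangle (nfs_sortP f) (nfs_sortP g)).
Qed.

Let normZ (a : R[i]) f : norm (a *: f) = `|a| * norm f.
Proof. exact: (nfs_normZ a (nfs_sortP f)). Qed.

Let norm_eq0 f : norm f = 0 -> f = 0.
Proof.
move=> /(congr1 (@complex.Re R))/= f0; apply: val_inj => /=.
exact: (nfs_norm_eq0 (nfs_sortP f)).
Qed.

HB.instance Definition _ :=
  Lmodule_isNormed.Build R[i] nfs_sort norm_triangle normZ norm_eq0.

Lemma nfs_normE (f : nfs_sort) : `|f| = (nfs_norm F f)%:C.
Proof. by []. Qed.

End NormedFunctionSpace.

Record banachFunctionSpace (R : realType) (X : topologicalType) := {
  bfs_nfs :> normedFunctionSpace R X ;
  bfs_complete : forall G : set_system (nfs_sort bfs_nfs),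
    ProperFilter G -> cauchy G -> cvg G
}.

Definition bfs_sort (R : realType) (X : topologicalType)
  (F : banachFunctionSpace R X) : Type := nfs_sort F.

Coercion bfs_sort : banachFunctionSpace >-> Sortclass.

HB.instance Definition _ (R : realType) (X : topologicalType)
  (F : banachFunctionSpace R X) := NormedModule.on (bfs_sort F).
HB.instance Definition _ (R : realType) (X : topologicalType)
  (F : banachFunctionSpace R X) :=
  Uniform_isComplete.Build (bfs_sort F) (@bfs_complete R X F).

Section Omega.
Context (R : realType) (X : topologicalType).

Definition solid (F : banachFunctionSpace R X) : Prop :=
  forall f g : X -> R[i]^o, nfs_set F f -> borel_fun g ->
    (forall x, `|g x| <= `|f x|) ->
    nfs_set F g /\ nfs_norm F g <= nfs_norm F f.

Definition comp_invariant (F : banachFunctionSpace R X) (a : X -> X) : Prop :=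
  forall f : X -> R[i]^o, nfs_set F f ->
    nfs_set F (f \o a) /\ nfs_norm F (f \o a) = nfs_norm F f.

Definition bounded_compact_support (f : X -> R[i]^o) : Prop :=
  bounded_fun f /\ compact (closure [set x | f x != 0]).

Record cond_Omega (F : banachFunctionSpace R X) (alpha alphaV : X -> X) :
    Prop := {
  Omega_solid : solid F ;
  Omega_comp : comp_invariant F alpha ;
  Omega_compV : comp_invariant F alphaV ;
  Omega_indic : forall E : set X, compact E -> nfs_set F \1_E ;
  Omega_dense : dense [set f : F | bounded_compact_support f]
}.

Definition weight (w : X -> R) : Prop :=
  [/\ borel_fun w, forall x, 0 < w x & bounded_fun w].

End Omega.

Section Cosine.
Context (R : realType) (X : topologicalType) (F : banachFunctionSpace R X).

(* [insubd] falls back to 0 outside [F]; see [wcompE]: under the standing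
   assumptions this never happens. *)
Definition wcomp (a : X -> X) (u : X -> R) (f : F) : F :=
  insubd (0 : F) (fun x => (u x)%:C * f (a x)).

Definition wT (alpha : X -> X) (w : X -> R) : F -> F := wcomp alpha w.

Definition wS (alphaV : X -> X) (w : X -> R) : F -> F :=
  wcomp alphaV (fun x => (w (alphaV x))^-1).

Definition cosine_op (alpha alphaV : X -> X) (w : X -> R) (n : nat) (f : F) :
    F :=
  (2^-1 : R[i]) *: (iter n (wT alpha w) f + iter n (wS alphaV w) f).
End Cosine.

Section BorelTheory.
Implicit Types S T X : topologicalType.

Lemma sigma_algebra_borel T : sigma_algebra setT (@borel T).
Proof. exact: smallest_sigma_algebra. Qed.

Lemma borel_open T (U : set T) : open U -> borel U.
Proof. exact: sub_sigma_algebra. Qed.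

Lemma borelC T (A : set T) : borel A -> borel (~` A).
Proof. by have [_ bC _] := sigma_algebra_borel T; rewrite -setTD; exact: bC. Qed.

Lemma borel_bigcup T (A : nat -> set T) :
  (forall i, borel (A i)) -> borel (\bigcup_i A i).
Proof. by have [_ _] := sigma_algebra_borel T; exact. Qed.

Lemma borelI T (A B : set T) : borel A -> borel B -> borel (A `&` B).
Proof.
move=> bA bB; rewrite -[A `&` B]setCK setCI; apply: borelC.
rewrite -bigcup2E; apply: borel_bigcup => -[|[|i]]; rewrite /bigcup2/=.
- exact: borelC.
- exact: borelC.
- by have [] := sigma_algebra_borel T.
Qed.

Lemma borel_funP S T (f : S -> T) :
  (forall U, open U -> borel (f @^-1` U)) -> borel_fun f.
Proof.
move=> bf; apply: smallest_sub => //.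
split=> [|A bA|A bA] /=.
- by rewrite preimage_set0; have [] := sigma_algebra_borel S.
- by rewrite setTD preimage_setC; exact: borelC.
- by rewrite preimage_bigcup; exact: borel_bigcup.
Qed.

Lemma real_complex_continuous (R : realType) :
  continuous (fun t : R => t%:C : R[i]^o).
Proof.
move=> t; apply/cvgrPdist_lt => /= e e0.
have e'0 : 0 < complex.Re e by move: e0; rewrite ltcE/= => /andP[].
have eE : e = (complex.Re e)%:C by rewrite RRe_real// gtr0_real.
near=> s; rewrite -rmorphB/= normc_def/= expr0n/= addr0 sqrtr_sqr eE ltcR.
by near: s; exact: cvgr_dist_lt.
Unshelve. all: by end_near. Qed.

Lemma borel_funM (R : realType) X (u : X -> R) (g : X -> R[i]^o) :
  borel_fun u -> borel_fun g -> borel_fun (fun x => (u x)%:C * g x : R[i]^o).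
Proof.
move=> bu bg; apply: borel_funP => U oU.
pose q (i : nat) : R := ratr (odflt 0 (unpickle i)).
pose W i k : set R[i]^o :=
  [set z : R[i]^o | forall t : R, `|q i - t| < k.+1%:R^-1 -> U (t%:C * z : R[i]^o)]^°.
rewrite [X in borel X](_ : _ = \bigcup_i \bigcup_k
    (u @^-1` ball (q i) k.+1%:R^-1 `&` g @^-1` W i k)).
  apply: borel_bigcup => i; apply: borel_bigcup => k; apply: borelI.
  - by apply: bu; apply: borel_open; exact: ball_open.
  - by apply: bg; apply: borel_open; exact: open_interior.
apply/seteqP; split=> [x /= Ux|x /= [i _ [k _ /= [uq /interior_subset]]]];
  last by apply.
have : nbhs ((u x)%:C * g x : R[i]^o) U by exact: open_nbhs_nbhs.
have ctn : (fun p : R * R[i]^o => (p.1%:C *: p.2 : R[i]^o)) p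
    @[p --> (u x, g x)] --> ((u x)%:C *: g x : R[i]^o).
  apply: cvgZ; last exact: cvg_snd.
  by apply: cvg_comp; [exact: cvg_fst|exact: real_complex_continuous].
move=> /ctn[[A B]/= [/nbhs_ballP[e/= e0 eA] nB] ABU].
have [k _ /(_ k (leqnn k)) ke] : \forall k \near \oo, k.+1%:R^-1 < e / 2.
  have e2 : 0 < e / 2 by rewrite divr_gt0.
  exact: (near_infty_natSinv_lt (PosNum e2)).
have ux : u x - k.+1%:R^-1 < u x + k.+1%:R^-1.
  by rewrite ltrD2l gtrN// invr_gt0.
have [r] := rat_in_itvoo ux; rewrite in_itv/= => /andP[r1 r2].
have rk : `|ratr r - u x| < k.+1%:R^-1.
  by rewrite ltr_distl r1 r2.
have qr : q (pickle r) = ratr r by rewrite /q pickleK.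
exists (pickle r) => //; exists k => //; split; first by rewrite /= /ball/= qr distrC distrC.
rewrite /=; apply: filterS nB => z Bz t /=; rewrite qr => rt.
apply: (ABU (t, z)); split=> //=; apply: eA; rewrite /ball/=.
rewrite -(subrK (ratr r) (u x)) -addrA (le_lt_trans (ler_normD _ _))//.
by rewrite (splitr e) ltrD// ?(lt_trans _ ke)// distrC.
Qed.

End BorelTheory.

Section CosineTheory.
Context (R : realType) (X : topologicalType) (F : banachFunctionSpace R X).

Lemma wcomp_in (a : X -> X) (u : X -> R) (f : X -> R[i]^o) :
  solid F -> comp_invariant F a -> borel_fun u -> bounded_fun u ->
  nfs_set F f -> nfs_set F (fun x => (u x)%:C * f (a x)).
Proof.
move=> sF cF bu [M [Mr uM]] /cF[Ffa _].
have {}uM : forall x, `|u x| <= M + 1.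
  by move=> x; apply: (uM (M + 1)) => //; rewrite ltrDl.
have := nfs_scale (M + 1)%:C Ffa.
move=> /sF /(_ (borel_funM bu (nfs_borel Ffa)))[]// x.
rewrite /= !normrM ler_wpM2r// !normc_def/= !expr0n/= !addr0 !sqrtr_sqr lecR.
exact: le_trans (uM x) (ler_norm _).
Qed.

Lemma wcompE (a : X -> X) (u : X -> R) (f : F) :
  solid F -> comp_invariant F a -> borel_fun u -> bounded_fun u ->
  wcomp a u f = (fun x => (u x)%:C * f (a x)) :> (X -> R[i]^o).
Proof.
move=> sF cF bu Bu; rewrite /wcomp -[LHS]/(val _) insubdK//.
apply/mem_set; apply: wcomp_in => //; exact: nfs_sortP.
Qed.

Lemma wTE (alpha alphaV : X -> X) (w : X -> R) (f : F) :
  cond_Omega F alpha alphaV -> weight w ->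
  wT alpha w f = (fun x => (w x)%:C * f (alpha x)) :> (X -> R[i]^o).
Proof. by move=> [sF cF _ _ _] [bw _ Bw]; exact: wcompE. Qed.

Lemma wSE (alpha alphaV : X -> X) (w : X -> R) (f : F) :
  cond_Omega F alpha alphaV -> borel_fun alphaV -> weight (fun x => (w x)^-1) ->
  wS alphaV w f = (fun x => f (alphaV x) / (w (alphaV x))%:C)
    :> (X -> R[i]^o).
Proof.
move=> [sF _ cF _ _] baV [bw _ Bw]; rewrite /wS wcompE//.
- by apply/funext => x; rewrite mulrC fmorphV.
- by move=> B bB; exact: (baV _ (bw B bB)).
- have [M [Mr wM]] := Bw; exists M; split=> // N MN x _; exact: (wM N MN (alphaV x)).
Qed.

Lemma wTK (alpha alphaV : X -> X) (w : X -> R) :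
  cond_Omega F alpha alphaV -> cancel alphaV alpha ->
  borel_fun alphaV -> weight w -> weight (fun x => (w x)^-1) ->
  cancel (@wT R X F alpha w) (@wS R X F alphaV w).
Proof.
move=> OF aVK baV ww wwV f; apply: val_inj; apply: funext => x.
rewrite -[LHS]/(wS alphaV w _ x) (wSE _ OF)// (wTE _ OF)// aVK mulrAC divff ?mul1r//.
by case: ww => _ w0 _; rewrite -(rmorph0 (real_complex R)) (inj_eq (@complexI R)) gt_eqF.
Qed.

End CosineTheory.

(* Main.v *)
(** Given bounded, compactly supported [f] and [g], let [K] contain both
    supports and, writing [H_k] for the paper's [F_k], put
      [v_k = 1_{D_k} f + 2 T^{n_k}(1_{E_k} g) + 2 S^{n_k}(1_{H_k} g)].
    Since [T S = S T = 1], the cosine operator [C^{(n_k)}] sends [v_k] to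
      [(T^{n_k} + S^{n_k})(1_{D_k} f) / 2 + T^{2 n_k}(1_{E_k} g)
         + S^{2 n_k}(1_{H_k} g) + 1_{D_k} g].
    By invariance of the norm under composition with [alpha], the five limits in
    the hypothesis say that [T^{n_k}], [S^{n_k}], [T^{2 n_k}] and [S^{2 n_k}]
    send the relevant indicators to 0 in norm, and solidity replaces these
    indicators by their products with [f] and [g]. Hence [v_k --> f] and
    [C^{(n_k)} v_k --> g]. *)

Require Import Defs.
From HB Require Import structures.
From mathcomp Require Import all_boot all_order all_algebra.
From mathcomp Require Import all_classical all_reals all_analysis.
From mathcomp Require Import complex.

Set Implicit Arguments.
Unset Strict Implicit.
Unset Printing Implicit Defensive.

Import Order.TTheory GRing.Theory Num.Theory.
Import numFieldNormedType.Exports.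

Local Open Scope classical_set_scope.
Local Open Scope complex_scope.
Local Open Scope ring_scope.

Lemma borel_fun_indic (R : realType) (X : topologicalType) (A : set X) :
  borel A -> borel_fun (\1_A : X -> R).
Proof.
move=> bA B _; rewrite preimage_indic.
by do 2 case: ifP => _ //; [exact: borel_open openT|exact: borelC|
  exact: borel_open open0].
Qed.

Lemma iter_cancel (T : Type) (f g : T -> T) n :
  cancel f g -> cancel (iter n f) (iter n g).
Proof. by move=> fK; elim: n => // n IHn x; rewrite iterSr iterS fK IHn. Qed.

(** The algebra behind [CE]: [p] and [q] stand for the terms in $T^{2n}$ and $S^{2n}$, while [c] and
    [d] stand for those where $T^n$ and $S^n$ cancel each other. *)
Lemma half_scale_sum (K : numFieldType) (V : lmodType K) (a b c d p q : V) :
  (2^-1 : K) *: (a + (2 : K) *: (p + d) + (b + (2 : K) *: (c + q))) =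
  (2^-1 : K) *: (a + b) + (p + q) + (c + d).
Proof.
rewrite addrACA -(scalerDr 2) (scalerDr 2^-1) scalerA mulVf ?pnatr_eq0//.
rewrite scale1r -[RHS]addrA.
by rewrite (addrC c q) (addrACA p) (addrC d c).
Qed.

(** [bounded_fun] yields a bound in [R[i]], the scalars of the norm, whereas estimates on [nfs_norm]
    need one in [R]. *)
Lemma bounded_fun_norm_le (R : realType) (X : topologicalType) (f : X -> R[i]^o) :
  bounded_fun f -> exists2 M : R, 0 <= M & forall x, `|f x| <= M%:C.
Proof.
move=> [M [Mr fM]].
have M1 : (complex.Re M)%:C = M by rewrite RRe_real.
have fle x : `|f x| <= (complex.Re M + 1)%:C.
  by rewrite rmorphD/= rmorph1 M1; apply: fM => //; rewrite ltrDl.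
exists `|complex.Re M + 1| => // x; apply: le_trans (fle x) _.
by rewrite lecR ler_norm.
Qed.

(** * Domination estimates from solidity *)

Section WeightedComposition.
Context (R : realType) (X : topologicalType) (F : banachFunctionSpace R X).
Hypothesis solidF : solid F.

(** Solidity compares [g] with [M *: f], which lies in [F] and has norm [M * nfs_norm F f]. *)
Lemma nfs_norm_le (f g : F) (M : R) : 0 <= M ->
  (forall x, `|g x| <= M%:C * `|f x|) -> nfs_norm F g <= M * nfs_norm F f.
Proof.
move=> M0 gf; have M0C : `|M%:C| = M%:C :> R[i] by rewrite ger0_norm// ler0c.
have [|_] := solidF (nfs_scale M%:C (nfs_sortP f)) (nfs_borel (nfs_sortP g)).
  by move=> x; rewrite [leRHS]normrM M0C.
move=> /le_trans; apply; rewrite -lecR (nfs_normZ _ (nfs_sortP f)).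
by rewrite rmorphM M0C.
Qed.

(** Passes from limits of the real-valued [nfs_norm] to limits in [F], whose norm takes values in
    [R[i]]; a positive [eps] there has zero imaginary part, so it is a real tolerance. *)
Lemma dominated_cvg0 (u e : nat -> F) (M : R) : 0 <= M ->
  (forall k x, `|u k x| <= M%:C * `|e k x|) ->
  nfs_norm F (e k) @[k --> \oo] --> (0 : R) -> u k @[k --> \oo] --> (0 : F).
Proof.
move=> M0 ue e0; apply/cvgrPdist_lt => /= eps eps0.
have eps'0 : 0 < complex.Re eps by move: eps0; rewrite ltcE/= => /andP[].
have epsE : eps = (complex.Re eps)%:C by rewrite RRe_real// gtr0_real.
have Me0 : M * nfs_norm F (e k) @[k --> \oo] --> (0 : R).
  by rewrite -(mulr0 M); apply: cvgM => //; exact: cvg_cst.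
near=> k; rewrite sub0r normrN nfs_normE epsE ltcR.
apply: (le_lt_trans (nfs_norm_le M0 (ue k))).
by near: k; exact: (cvgr_lt _ Me0).
Unshelve. all: by end_near. Qed.

(** * Iterates of weighted compositions and their norms *)

Section Multiplier.
Context (a : X -> X) (u : X -> R).
Hypotheses (invF : comp_invariant F a) (bu : borel_fun u) (Bu : bounded_fun u).

Lemma iter_wcompE n (f : F) x : iter n (wcomp a u) f x =
  (\prod_(0 <= s < n) u (iter s a x))%:C * f (iter n a x).
Proof.
elim: n x => [|n IHn] x; first by rewrite big_geq// mul1r.
rewrite iterS [LHS](congr1 (@^~ x) (wcompE _ solidF invF bu Bu)) IHn.
rewrite big_nat_recl//= rmorphM/= -mulrA -iterSr; congr (_ * (_%:C * _)).
by apply: eq_bigr => s _; rewrite -iterSr.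
Qed.

Lemma iter_wcompD n (f g : F) :
  iter n (wcomp a u) (f + g) = iter n (wcomp a u) f + iter n (wcomp a u) g.
Proof.
apply: val_inj; apply/funext => x.
rewrite [LHS]iter_wcompE.
by rewrite [RHS](congr2 +%R (iter_wcompE _ _ _) (iter_wcompE _ _ _)) -mulrDr.
Qed.

Lemma iter_wcompZ n (c : R[i]) (f : F) :
  iter n (wcomp a u) (c *: f) = c *: iter n (wcomp a u) f.
Proof.
apply: val_inj; apply/funext => x.
by rewrite [LHS]iter_wcompE [RHS](congr1 ( *%R c) (iter_wcompE _ _ _)) mulrCA.
Qed.

Lemma iter_wcomp_dominated n (f e : F) (M : R) :
  (forall x, `|f x| <= M%:C * `|e x|) ->
  forall x, `|iter n (wcomp a u) f x| <= M%:C * `|iter n (wcomp a u) e x|.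
Proof. by move=> fe x; rewrite !iter_wcompE !normrM mulrCA ler_wpM2l. Qed.

(* Obtained by composing [iter n (wcomp a u) f] with [iter n b]. *)
Lemma nfs_norm_iter_wcomp (b : X -> X) n (f : F) :
  cancel b a -> comp_invariant F b ->
  nfs_norm F (iter n (wcomp a u) f) =
  nfs_norm F (fun x => f x * (\prod_(1 <= s < n.+1) u (iter s b x))%:C).
Proof.
move=> bK invb.
have invbn m (g : X -> R[i]^o) : nfs_set F g ->
    nfs_set F (g \o iter m b) /\ nfs_norm F (g \o iter m b) = nfs_norm F g.
  move=> Fg; elim: m => [//|m [Fgm <-]].
  have := invb _ Fgm; rewrite (_ : (g \o iter m b) \o b = g \o iter m.+1 b)//.
  by apply/funext => x /=; rewrite -iterSr.
have iterK m s x : (s <= m)%N -> iter s a (iter m b x) = iter (m - s) b x.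
  elim: s m => [|s IHs] [|m]// sm; first by rewrite subSS -IHs// iterSr/= bK.
rewrite -(invbn n _ (nfs_sortP _)).2; congr nfs_norm; apply/funext => x /=.
rewrite iter_wcompE iterK// subnn mulrC; congr (_ * _%:C).
(* By [iterK] the factor of index [s] is $u(b^{n-s}x)$; reversing the product moves the range from
   $0,\dots,n-1$ to $1,\dots,n$. *)
rewrite big_nat_rev/= big_add1/= !big_nat; apply: eq_bigr => s /andP[_ sn].
by rewrite add0n iterK ?leq_subr// subKn.
Qed.

End Multiplier.

(** * Restrictions to Borel sets *)

(* Multiplication by [\1_A], seen as a weighted composition along the identity. *)
Definition restr (A : set X) : F -> F := wcomp id (\1_A : X -> R).

Lemma restrE (A : set X) (f : F) x : borel A -> restr A f x = \1_A x * f x.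
Proof.
move=> bA; rewrite /restr (congr1 (@^~ x) (wcompE _ solidF _ _ _))//.
- by rewrite /= !indicE rmorph_nat.
- exact: borel_fun_indic.
- exists 1; split=> // N N1 y _; rewrite /= indicE.
  by case: (_ \in _); rewrite ?normr1 ?normr0 ltW// (lt_trans _ N1).
Qed.

Lemma restr_support (A : set X) (f : F) :
  borel A -> (forall x, f x != 0 -> A x) -> restr A f = f.
Proof.
move=> bA fA; apply: val_inj; apply/funext => x; rewrite [LHS]restrE// indicE.
have [/fA Ax|/negPn/eqP fx0] := boolP (f x != 0); last first.
  by rewrite fx0 mulr0 [RHS]fx0.
by rewrite mem_set// mul1r.
Qed.

(** Serves twice: to split [D k] into [E k] and [H k], and to split [K] into [D k] and the rest. *)
Lemma restrU (A B : set X) (f : F) :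
  borel A -> borel B -> borel (A `|` B) -> A `&` B = set0 ->
  restr (A `|` B) f = restr A f + restr B f.
Proof.
move=> bA bB bAB AB0; apply: val_inj; apply/funext => x.
rewrite [LHS]restrE// [RHS](congr2 +%R (restrE f x bA) (restrE f x bB)).
rewrite -mulrDl !indicE in_setU; have [/set_mem Ax|_] := boolP (x \in A).
  have nBx : ~ B x by move=> Bx; have : (A `&` B) x by []; rewrite AB0.
  by rewrite (memNset nBx) addr0.
by rewrite add0r.
Qed.

(* The norms in the hypothesis are those of [T^m] and [S^m] applied to [\1_(B k)],
   which is the restriction to [B k] of the element [\1_K] of [F]. *)
Lemma iter_wcomp_restr_cvg0 (a b : X -> X) (u : X -> R) (K : set X)
    (A B : nat -> set X) (n : nat -> nat) (f : F) (M : R) :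
  cancel b a -> comp_invariant F a -> comp_invariant F b ->
  borel_fun u -> bounded_fun u ->
  nfs_set F \1_K -> (forall k, borel (A k)) -> (forall k, borel (B k)) ->
  (forall k, A k `<=` B k) -> (forall k, B k `<=` K) ->
  0 <= M -> (forall x, `|f x| <= M%:C) ->
  nfs_norm F (fun x => \1_(B k) x *
    (\prod_(1 <= s < (n k).+1) u (iter s b x))%:C) @[k --> \oo] --> (0 : R) ->
  iter (n k) (wcomp a u) (restr (A k) f) @[k --> \oo] --> (0 : F).
Proof.
move=> bK invA invB bu Bu FK bA bB AB BK M0 fM.
pose e : F := NfsSort (mem_set FK).
have eE k x : restr (B k) e x = \1_(B k) x.
  rewrite restrE//= !indicE; have [/set_mem/BK Kx|_] := boolP (x \in B k).
    by rewrite mem_set// mulr1.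
  by rewrite mul0r.
move=> cvg0; apply: (dominated_cvg0
  (e := fun k => iter (n k) (wcomp a u) (restr (B k) e)) M0).
  (* On [A k] the right side is [M]; off [A k] the left side vanishes. Letting [B k] exceed [A k]
     allows a limit over [D k] to control restrictions to [E k] and [H k]. *)
  move=> k; apply: iter_wcomp_dominated => // x.
  rewrite eE restrE// normrM mulrC !indicE.
  have [/set_mem/AB Bx|_] := boolP (x \in A k); last first.
    by rewrite normr0 mulr0 mulr_ge0// ler0c.
  by rewrite mem_set// normr1 !mulr1.
apply: cvg_trans cvg0; apply: near_eq_cvg; apply: nearW => k.
rewrite (nfs_norm_iter_wcomp invA bu Bu _ _ bK invB).
by congr nfs_norm; apply/funext => x; rewrite -eE.
Qed.

End WeightedComposition.

(** * Transitivity of the cosine operators *)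

Lemma wSK (R : realType) (X : topologicalType) (F : banachFunctionSpace R X)
    (alpha alphaV : X -> X) (w : X -> R) :
  cond_Omega F alpha alphaV -> cancel alpha alphaV -> borel_fun alphaV ->
  weight w -> weight (fun x => (w x)^-1) ->
  cancel (@wS R X F alphaV w) (wT alpha w).
Proof.
move=> OF aK baV ww wwV f; apply: val_inj; apply/funext => x.
rewrite [LHS](congr1 (@^~ x) (wTE _ OF ww)) (congr1 (@^~ _) (wSE _ OF baV wwV)).
rewrite aK mulrC divfK// (inj_eq (@complexI R) _ 0).
by case: ww => _ w0 _; rewrite gt_eqF.
Qed.

Theorem theorem3p7 (R : realType) (X : topologicalType)
    (alpha alphaV : X -> X)
    (alphaK : cancel alpha alphaV) (alphaVK : cancel alphaV alpha)
    (borel_alpha : borel_fun alpha) (borel_alphaV : borel_fun alphaV)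
    (F : banachFunctionSpace R X)
    (F_separable : separable F)
    (F_infdim : @infinite_dimensional R[i] F)
    (F_Omega : cond_Omega F alpha alphaV)
    (w : X -> R) (weight_w : weight w) (weight_wV : weight (fun x => (w x)^-1))
    (hyp : forall K : set X, compact K ->
      exists (D E H : nat -> set X) (n : nat -> nat),
        [/\ forall k, [/\ borel (D k), borel (E k) & borel (H k)],
            forall k, [/\ D k `<=` K, E k `<=` K & H k `<=` K],
            increasing_seq n /\ (forall k, (0 < n k)%N) &
            forall k, D k = E k `|` H k /\ E k `&` H k = set0] /\
        [/\ nfs_norm F (\1_(K `\` D k)) @[k --> \oo] --> (0 : R),
            nfs_norm F (fun x => \1_(D k) x *
              (\prod_(1 <= s < (n k).+1) w (iter s alphaV x))%:C)
              @[k --> \oo] --> (0 : R),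
            nfs_norm F (fun x => \1_(D k) x *
              ((\prod_(0 <= s < n k) w (iter s alpha x))^-1)%:C)
              @[k --> \oo] --> (0 : R),
            nfs_norm F (fun x => \1_(E k) x *
              (\prod_(1 <= s < (2 * n k).+1) w (iter s alphaV x))%:C)
              @[k --> \oo] --> (0 : R) &
            nfs_norm F (fun x => \1_(H k) x *
              ((\prod_(0 <= s < 2 * n k) w (iter s alpha x))^-1)%:C)
              @[k --> \oo] --> (0 : R)]) :
  topologically_transitive (cosine_op (F := F) alpha alphaV w).
Proof.
have [solidF invA invV indicF denseF] := F_Omega.
move=> U W oU oW U0 W0.
have [f [Uf [/bounded_fun_norm_le[Mf Mf0 fM] Kf]]] := denseF U U0 oU.
have [g [Wg [/bounded_fun_norm_le[Mg Mg0 gM] Kg]]] := denseF W W0 oW.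
set Sf := closure _ in Kf; set Sg := closure _ in Kg.
have /hyp[D [E [H [n]]]] : compact (Sf `|` Sg) by exact: compactU.
set K := _ `|` _ => -[[bDEH DEHK [_ n0] DEH] [KD0 TD0 SD0 TE0 SH0]].
(* Compact sets need not be Borel in an arbitrary [X]; this [K] is closed, being a union of two
   closures. *)
have bK : borel K.
  rewrite -[K]setCK; apply: borelC; apply: borel_open.
  by rewrite openC; apply: closedU; exact: closed_closure.
have FK : nfs_set F \1_K by apply: indicF; exact: compactU.
have [bw w0 Bw] := weight_w; have [bwV _ BwV] := weight_wV.
(* [S] is the weighted composition along [alphaV] with weight [wV], so the lemmas used for [T] apply
   to it with [alpha] and [alphaV] exchanged. *)
pose wV x := (w (alphaV x))^-1.
have bwVa : borel_fun wV by move=> B bB; exact: borel_alphaV _ (bwV B bB).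
have BwVa : bounded_fun wV.
  have [M [Mr wM]] := BwV; exists M; split=> // N MN x _.
  exact: (wM N MN (alphaV x)).
(* The [alphaV] inside [wV] absorbs one iterate of [alpha], which shifts the indices from
   $1,\dots,m$ to $0,\dots,m-1$. *)
have prodwV m x : \prod_(1 <= s < m.+1) wV (iter s alpha x) =
    (\prod_(0 <= s < m) w (iter s alpha x))^-1.
  rewrite big_add1/= -prodfV; apply: eq_bigr => s _.
  by rewrite /wV/= alphaK.
pose T := wT (F := F) alpha w; pose S := wS (F := F) alphaV w.
have Tcvg0 (A B : nat -> set X) (m : nat -> nat) h M :
    (forall k, borel (A k)) -> (forall k, borel (B k)) ->
    (forall k, A k `<=` B k) -> (forall k, B k `<=` K) ->
    0 <= M -> (forall x, `|(h : F) x| <= M%:C) ->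
    nfs_norm F (fun x => \1_(B k) x *
      (\prod_(1 <= s < (m k).+1) w (iter s alphaV x))%:C)
      @[k --> \oo] --> (0 : R) ->
    iter (m k) T (restr (A k) h) @[k --> \oo] --> (0 : F).
  by exact: (iter_wcomp_restr_cvg0 solidF alphaVK invA invV bw Bw FK).
have Scvg0 (A B : nat -> set X) (m : nat -> nat) h M :
    (forall k, borel (A k)) -> (forall k, borel (B k)) ->
    (forall k, A k `<=` B k) -> (forall k, B k `<=` K) ->
    0 <= M -> (forall x, `|(h : F) x| <= M%:C) ->
    nfs_norm F (fun x => \1_(B k) x *
      ((\prod_(0 <= s < m k) w (iter s alpha x))^-1)%:C)
      @[k --> \oo] --> (0 : R) ->
    iter (m k) S (restr (A k) h) @[k --> \oo] --> (0 : F).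
  move=> bA bB AB BK M0 hM cvg0.
  apply: (iter_wcomp_restr_cvg0 solidF alphaK invV invA bwVa BwVa FK
    bA bB AB BK M0 hM).
  by under eq_fun do under eq_fun do rewrite prodwV.
have ED k : E k `<=` D k by have [-> _] := DEH k; exact: subsetUl.
have HD k : H k `<=` D k by have [-> _] := DEH k; exact: subsetUr.
have bD k : borel (D k) by have [] := bDEH k.
have bE k : borel (E k) by have [] := bDEH k.
have bH k : borel (H k) by have [] := bDEH k.
have DK k : D k `<=` K by have [] := DEHK k.
have EK k : E k `<=` K by have [] := DEHK k.
have HK k : H k `<=` K by have [] := DEHK k.
have bKD k : borel (K `\` D k) by apply: borelI => //; exact: borelC.
have restrD_cvg h M : 0 <= M -> (forall x, `|(h : F) x| <= M%:C) ->
    (forall x, h x != 0 -> K x) ->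
    restr (D k) h @[k --> \oo] --> h.
  move=> M0 hM hK.
  (* With zero iterations the weight product is empty, so the limit that [Tcvg0] asks for is
     [KD0]. *)
  have KDh0 : iter 0 (wT alpha w) (restr (K `\` D k) h)
      @[k --> \oo] --> (0 : F).
    apply: (Tcvg0 (fun k => K `\` D k) (fun k => K `\` D k) (fun=> 0)%N
      h M) => //.
      by move=> k x [].
    by under eq_fun do under eq_fun do rewrite big_geq// mulr1.
  have DE k : restr (D k) h = h - restr (K `\` D k) h.
    apply/eqP; rewrite eq_sym subr_eq -restrU// ?setDUK ?(restr_support _ _ hK)//.
    by apply/seteqP; split=> // x [Dx [_]].
  under eq_fun do rewrite DE.
  have := cvgB (cvg_cst h) KDh0; rewrite subr0; exact.
have fK x : f x != 0 -> K x.
  by move=> fx; left; apply: subset_closure.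
have gK x : g x != 0 -> K x.
  by move=> fx; right; apply: subset_closure.
pose v k : F := restr (D k) f + (2%:R : R[i]) *:
  (iter (n k) T (restr (E k) g) + iter (n k) S (restr (H k) g)).
have vf : v k @[k --> \oo] --> f.
  rewrite -[f]addr0; apply: cvgD; first exact: (restrD_cvg f Mf).
  rewrite -(scaler0 _ (2%:R : R[i])); apply: cvgZr.
  (* Since [E k] and [H k] lie in [D k], the limits [TD0] and [SD0] suffice. *)
  rewrite -[0 : F]addr0; apply: cvgD; first exact: (Tcvg0 E D n g Mg).
  exact: (Scvg0 H D n g Mg).
have Cvg : cosine_op alpha alphaV w (n k) (v k) @[k --> \oo] --> g.
  have CE k : cosine_op alpha alphaV w (n k) (v k) =
      (2^-1 : R[i]) *: (iter (n k) T (restr (D k) f) +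
                        iter (n k) S (restr (D k) f)) +
      (iter (2 * n k) T (restr (E k) g) + iter (2 * n k) S (restr (H k) g)) +
      restr (D k) g.
    have [DEk EH0] := DEH k.
    have -> : restr (D k) g = restr (E k) g + restr (H k) g.
      by rewrite DEk restrU// -DEk.
    rewrite !mul2n -!addnn !iterD /cosine_op -/T -/S /v.
    rewrite (iter_wcompD solidF invA bw Bw) (iter_wcompZ solidF invA bw Bw).
    rewrite (iter_wcompD solidF invA bw Bw).
    rewrite (iter_wcompD solidF invV bwVa BwVa) (iter_wcompZ solidF invV bwVa BwVa).
    rewrite (iter_wcompD solidF invV bwVa BwVa).
    (* The mixed terms lose all powers: $S^nT^n$ gives back [restr (E k) g] and $T^nS^n$ gives back
       [restr (H k) g], which add up to [restr (D k) g]. *)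
    rewrite (iter_cancel _ (wTK F_Omega alphaVK borel_alphaV weight_w weight_wV)).
    rewrite (iter_cancel _ (wSK F_Omega alphaK borel_alphaV weight_w weight_wV)).
    exact: half_scale_sum.
  under eq_fun do rewrite CE.
  have cvg0D (a b : nat -> F) : a k @[k --> \oo] --> (0 : F) ->
      b k @[k --> \oo] --> (0 : F) -> a k + b k @[k --> \oo] --> (0 : F).
    by move=> a0 b0; rewrite -[0 : F]addr0; exact: cvgD.
  have Df0 := cvg0D _ _
    (Tcvg0 D D n f Mf bD bD (fun=> @subset_refl _ _) DK Mf0 fM TD0)
    (Scvg0 D D n f Mf bD bD (fun=> @subset_refl _ _) DK Mf0 fM SD0).
  have EHg0 := cvg0D _ _
    (Tcvg0 E E _ g Mg bE bE (fun=> @subset_refl _ _) EK Mg0 gM TE0)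
    (Scvg0 H H _ g Mg bH bH (fun=> @subset_refl _ _) HK Mg0 gM SH0).
  have hDf0 : (2^-1 : R[i]) *: (iter (n k) T (restr (D k) f) +
      iter (n k) S (restr (D k) f)) @[k --> \oo] --> (0 : F).
    by rewrite -(scaler0 _ (2^-1 : R[i])); exact: cvgZr.
  rewrite -[X in nbhs X](add0r g).
  by apply: cvgD (cvg0D _ _ hDf0 EHg0) (restrD_cvg g Mg Mg0 gM gK).
(* Both limits are along the same sequence, so one index [k] serves for [U] and [W] at once. *)
have [k [Uk Wk]] : exists k, U (v k) /\ W (cosine_op alpha alphaV w (n k) (v k)).
  apply: (@filter_ex _ \oo); apply: filterI.
    exact: vf _ (open_nbhs_nbhs (conj oU Uf)).
  exact: Cvg _ (open_nbhs_nbhs (conj oW Wg)).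
exists (n k) => //; exists (cosine_op alpha alphaV w (n k) (v k)).
by split=> //; exists (v k).
Qed.
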